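(* Let $a,b>0$. The length of the longest line segment that can move around the corner in the corridor $\mathcal C_{03}$, $\mathcal C_{11}$, or $\mathcal C_{13}$ is $(a^{2/3}+b^{2/3})^{3/2}$, whereas for the remaining five corridors $\mathcal C_{00},\mathcal C_{01},\mathcal C_{02},\mathcal C_{10},\mathcal C_{12}$ this can be done for a segment of arbitrary length.
   Context: Fix $a,b>0$. In the plane $\mathbb R^2$ with coordinates $(x,y)$ set $\mathcal D=\{x=a,\ 0<y<b\}$, $\mathcal A_0=\mathcal D\cup\{0<x<a\}$, $\mathcal B_0=\mathcal D\cup\{x>a\}$, $\mathcal A_1=\mathcal A_0\cap\{y>0\}$, $\mathcal B_1=\mathcal B_0\cap\{y>0\}$, $\mathcal B_2=\mathcal B_0\cap\{y<b\}$, $\mathcal B_3=\mathcal B_0\cap\{0<y<b\}$, and $\mathcal C_{ij}=\mathcal A_i\cup\mathcal B_j$ for $(i,j)\in\{0,1\}\times\{0,1,2,3\}$. An open rectangle $R$ ''can move around the corner in $\mathcal C_{ij}$'' if there is a continuous path $\Phi_t$, $t\in[0,1]$, in the Euclidean group $E(2)$ of rigid motions of the plane such that $\Phi_0(R)\subset\mathcal A_i$, $\Phi_1(R)\subset\mathcal B_j$ and $\Phi_t(R)\subset\mathcal C_{ij}$ for all $t\in[0,1]$. A line segment is regarded as the degenerate case $d=0$ of a rectangle with side lengths $c\ge d$, and the same terminology is used for it.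
   Formalization: ''Longest'' is read as the supremum of the lengths of movable segments: since the corner (a,b) lies in no corridor, a segment of length exactly (a^{2/3}+b^{2/3})^{3/2} cannot pass, so no longest one exists. Proved both for segments with and without endpoints. *)

(* Defs.v *)
From HB Require Import structures.
From mathcomp Require Import all_boot all_order all_algebra.
From mathcomp Require Import all_classical all_reals all_analysis.

Set Implicit Arguments.
Unset Strict Implicit.
Unset Printing Implicit Defensive.

Import Order.TTheory GRing.Theory Num.Theory.
Import numFieldNormedType.Exports.

Local Open Scope classical_set_scope.
Local Open Scope ring_scope.

Section plane.
Variable R : realType.

(* Column vectors, so that matrices act on the left; the library norm on this
   type is the max norm, hence the separate Euclidean distance below. *)
Definition plane : Type := 'cV[R]_2.

Definition xcoord (p : plane) : R := p 0 0.
Definition ycoord (p : plane) : R := p 1 0.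

Definition eucl_dist (p q : plane) : R :=
  Num.sqrt ((xcoord p - xcoord q) ^+ 2 + (ycoord p - ycoord q) ^+ 2).

(* The pair (M, v) stands for the map p |-> M p + v; it is a rigid motion when
   M is orthogonal.  Paths of motions are continuous for the product topology
   on pairs, which induces the usual topology of E(2). *)
Definition E2 : set ('M[R]_2 * 'cV[R]_2) := [set g | g.1^T *m g.1 = 1%:M].

Definition motion (g : 'M[R]_2 * 'cV[R]_2) (p : plane) : plane :=
  g.1 *m p + g.2.

Definition can_move (A B S : set plane) : Prop :=
  exists Phi : R -> 'M[R]_2 * 'cV[R]_2,
    [/\ {within `[0, 1], continuous Phi},
        (forall t, 0 <= t <= 1 -> E2 (Phi t)),
        motion (Phi 0) @` S `<=` A,
        motion (Phi 1) @` S `<=` B &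
        forall t, 0 <= t <= 1 -> motion (Phi t) @` S `<=` A `|` B].

(* The segment from p to q, with its endpoints if e is true and without them
   (as the flat limit of open rectangles) if e is false. *)
Definition segment (e : bool) (p q : plane) : set plane :=
  [set (1 - t) *: p + t *: q |
     t in [set t : R | if e then 0 <= t <= 1 else 0 < t < 1]].

(* The longest movable segment is to be read as a supremum of this set: since
   the corner (a, b) lies in no corridor below, a finite supremum is not
   attained. *)
Definition movable_lengths (e : bool) (A B : set plane) : set R :=
  [set l | 0 < l /\
    exists p q : plane, eucl_dist p q = l /\ can_move A B (segment e p q)].

Variables a b : R.

Definition door : set plane := [set p | xcoord p = a /\ 0 < ycoord p < b].

Definition A0 : set plane := door `|` [set p | 0 < xcoord p < a].
Definition A1 : set plane := A0 `&` [set p | 0 < ycoord p].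

Definition B0 : set plane := door `|` [set p | a < xcoord p].
Definition B1 : set plane := B0 `&` [set p | 0 < ycoord p].
Definition B2 : set plane := B0 `&` [set p | ycoord p < b].
Definition B3 : set plane := B0 `&` [set p | 0 < ycoord p < b].

End plane.

(* Main.v *)
(* Write a = al^3, b = be^3 and s^2 = al^2 + be^2, so that L = s^3.  A segment
   in direction (al, -be)/s of length at least L exceeds a horizontally and b
   vertically.  If it crosses the door, its parts on the two sides are shorter
   than a s/al and b s/be, which add up to L; so it cannot cross, and the
   intermediate value theorem shows that a long segment would have to do so on
   its way.  Conversely, for l < L a ladder slides along two lines parallel to
   the outer walls, because al^3/c + be^3/d >= s^3 when c^2 + d^2 = 1.  In the
   other five corridors a steep line through the door has long pieces on both
   sides, and the segment slides along it. *)
Require Import Defs.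
From HB Require Import structures.
From mathcomp Require Import all_boot all_order all_algebra.
From mathcomp Require Import all_classical all_reals all_analysis.
From mathcomp Require Import ring lra.

Import Order.TTheory GRing.Theory Num.Theory.
Import numFieldNormedType.Exports.

Local Open Scope classical_set_scope.
Local Open Scope ring_scope.

(** * Cube roots and the two extremal inequalities *)

(** With cube roots as parameters the fractional powers disappear, and the later estimates become
    polynomial or rational in [al], [be], [s]. *)
Lemma cube_roots_data (R : realType) (a b : R) : 0 < a -> 0 < b ->
  exists al be s : R, [/\ 0 < al, 0 < be & 0 < s] /\
    [/\ al ^+ 3 = a, be ^+ 3 = b, s ^+ 2 = al ^+ 2 + be ^+ 2 &
        s ^+ 3 = (a `^ (2 / 3) + b `^ (2 / 3)) `^ (3 / 2)].
Proof.
move=> a0 b0.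
have sq c : 0 < c -> c `^ (2 / 3) = (c `^ 3^-1) ^+ 2.
  by move=> c0; rewrite -powR_mulrn ?powR_ge0// -powRrM mulrC.
have cube c : 0 < c -> (c `^ 3^-1) ^+ 3 = c.
  move=> c0; rewrite -powR_mulrn ?powR_ge0// -powRrM mulVf ?pnatr_eq0//.
  by rewrite powRr1 ?ltW.
have al0 : 0 < a `^ 3^-1 by rewrite powR_gt0.
have be0 : 0 < b `^ 3^-1 by rewrite powR_gt0.
have sum0 : 0 < a `^ (2 / 3) + b `^ (2 / 3) by rewrite addr_gt0 ?powR_gt0.
exists (a `^ 3^-1), (b `^ 3^-1), ((a `^ (2 / 3) + b `^ (2 / 3)) `^ 2^-1).
split; split; rewrite ?cube ?powR_gt0//; last first.
  by rewrite -powR_mulrn ?powR_ge0// -powRrM [2^-1 * _]mulrC.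
  rewrite -!sq// -powR_mulrn ?powR_ge0// -powRrM mulVf ?pnatr_eq0//.
  by rewrite powRr1// ltW.
Qed.

(* Tangent line at [k z = 1] of the convex function [w |-> w ^ (-1/2)],
   [w = z ^ 2]. *)
Lemma inv_ge_tangent (R : realFieldType) (k z : R) : 0 < k -> 0 < z ->
  (3 * k - k ^+ 3 * z ^+ 2) / 2 <= z^-1.
Proof.
move=> k0 z0; rewrite -[z^-1]mul1r ler_pdivlMr//.
have kz0 : 0 < k * z by rewrite mulr_gt0.
(* With [u = k * z], the gap multiplied by [z] is half of [u ^+ 3 - 3 * u + 2], which has a double
   root at 1. *)
have h : 0 <= (k * z - 1) ^+ 2 * (k * z + 2).
  by rewrite mulr_ge0 ?sqr_ge0// addr_ge0 ?ltW.
suff : (3 * k - k ^+ 3 * z ^+ 2) / 2 * z =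
  1 - (k * z - 1) ^+ 2 * (k * z + 2) / 2 by lra.
by field.
Qed.

(** The right-hand side is the length of a ladder with direction cosines [c], [d] touching both
    outer walls and the corner. The tangents at [z = u / s], for [u] equal to [al] and [be], give
    [z ^+ 2] the same coefficient, so the variable terms add up to a constant. *)
Lemma ladder_le (R : realFieldType) (al be s c d : R) :
  0 < al -> 0 < be -> 0 < s -> s ^+ 2 = al ^+ 2 + be ^+ 2 ->
  0 < c -> 0 < d -> c ^+ 2 + d ^+ 2 = 1 ->
  s ^+ 3 <= al ^+ 3 / c + be ^+ 3 / d.
Proof.
move=> al0 be0 s0 s2 c0 d0 cd.
have t (u z : R) : 0 < u -> 0 < z ->
    (3 * s * u ^+ 2 - s ^+ 3 * z ^+ 2) / 2 <= u ^+ 3 / z.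
  move=> u0 z0; have su0 : 0 < s / u by rewrite divr_gt0.
  have := inv_ge_tangent _ (s / u) z su0 z0.
  have u30 : 0 < u ^+ 3 by rewrite exprn_gt0.
  rewrite -(ler_pM2l u30); congr (_ <= _); field; lra.
have := lerD (t _ _ al0 c0) (t _ _ be0 d0).
apply: le_trans; rewrite le_eqVlt; apply/orP; left; apply/eqP.
transitivity ((3 * s * (al ^+ 2 + be ^+ 2) - s ^+ 3 * (c ^+ 2 + d ^+ 2)) / 2).
  by rewrite -s2 cd; field.
by field.
Qed.

(** The door abscissa cuts the segment into fractions [t] and [1 - t]. The width of the first part
    bounds [t * l] by [al ^+ 2 * s], the height of the second bounds [(1 - t) * l] by [be ^+ 2 * s],
    and these bounds add up to [s ^+ 3]. *)
Lemma crossing_bound (R : realFieldType) (al be s l x1 y1 x2 y2 : R) :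
  0 < al -> 0 < be -> 0 < s -> s ^+ 2 = al ^+ 2 + be ^+ 2 ->
  0 < x1 -> x1 < al ^+ 3 -> al ^+ 3 < x2 ->
  (x2 - x1) * s = l * al -> `|y1 - y2| * s = l * be ->
  (forall t, 0 <= t <= 1 -> (1 - t) * x1 + t * x2 = al ^+ 3 ->
    `|(1 - t) * y1 + t * y2 - y2| < be ^+ 3) ->
  l < s ^+ 3.
Proof.
move=> al0 be0 s0 s2 x10 x1a ax2 hx hy door.
pose t := (al ^+ 3 - x1) / (x2 - x1).
have x12 : 0 < x2 - x1 by lra.
have tx : t * (x2 - x1) = al ^+ 3 - x1 by rewrite divfK// gt_eqF.
have t0 : 0 <= t by rewrite divr_ge0// ltW//; lra.
have t1 : t <= 1 by rewrite ler_pdivrMr// mul1r; lra.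
have t01 : 0 <= t <= 1 by apply/andP.
have tE : (1 - t) * x1 + t * x2 = al ^+ 3.
  by rewrite -[RHS](subrK x1) -tx; ring.
have := door t t01 tE.
have -> : (1 - t) * y1 + t * y2 - y2 = (1 - t) * (y1 - y2) by ring.
rewrite normrM ger0_norm ?subr_ge0// => hlt.
have hA : t * l < al ^+ 2 * s.
  rewrite -(ltr_pM2r al0) -mulrA -hx mulrA tx.
  have -> : al ^+ 2 * s * al = al ^+ 3 * s by ring.
  by rewrite ltr_pM2r//; lra.
have hB : (1 - t) * l < be ^+ 2 * s.
  rewrite -(ltr_pM2r be0) -mulrA -hy mulrA.
  have -> : be ^+ 2 * s * be = be ^+ 3 * s by ring.
  by rewrite ltr_pM2r.
have -> : s ^+ 3 = al ^+ 2 * s + be ^+ 2 * s by rewrite -mulrDl -s2; ring.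
lra.
Qed.

(** * Coordinates, rigid motions and segments *)

Lemma mulmx2E (R : pzSemiRingType) (m n : nat) (A : 'M[R]_(m, 2))
    (B : 'M[R]_(2, n)) i j :
  (A *m B) i j = A i 0 * B 0 j + A i 1 * B 1 j.
Proof.
rewrite mxE !big_ord_recl big_ord0 addr0.
by rewrite (_ : lift ord0 ord0 = 1)//; apply/val_inj.
Qed.

Lemma xcoordD (R : realType) (p q : plane R) :
  xcoord (p + q) = xcoord p + xcoord q.
Proof. by rewrite /xcoord mxE. Qed.

Lemma ycoordD (R : realType) (p q : plane R) :
  ycoord (p + q) = ycoord p + ycoord q.
Proof. by rewrite /ycoord mxE. Qed.

Lemma xcoordZ (R : realType) (k : R) (p : plane R) :
  xcoord (k *: p) = k * xcoord p.
Proof. by rewrite /xcoord mxE. Qed.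

Lemma ycoordZ (R : realType) (k : R) (p : plane R) :
  ycoord (k *: p) = k * ycoord p.
Proof. by rewrite /ycoord mxE. Qed.

Lemma sqr_eucl_dist (R : realType) (p q : plane R) :
  eucl_dist p q ^+ 2 =
    (xcoord p - xcoord q) ^+ 2 + (ycoord p - ycoord q) ^+ 2.
Proof. by rewrite sqr_sqrtr// addr_ge0 ?sqr_ge0. Qed.

Lemma motion_isometry (R : realType) (g : 'M[R]_2 * 'cV[R]_2) (p q : plane R) :
  E2 g -> eucl_dist (motion g p) (motion g q) = eucl_dist p q.
Proof.
rewrite /E2 /= => gE.
have normE (d : plane R) : (d^T *m d) 0 0 = xcoord d ^+ 2 + ycoord d ^+ 2.
  by rewrite mulmx2E !mxE /xcoord /ycoord !expr2.
have xN (u v : plane R) : xcoord u - xcoord v = xcoord (u - v).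
  by rewrite /xcoord !mxE.
have yN (u v : plane R) : ycoord u - ycoord v = ycoord (u - v).
  by rewrite /ycoord !mxE.
rewrite /eucl_dist !xN !yN -!normE; congr Num.sqrt.
have -> : motion g p - motion g q = g.1 *m (p - q).
  by rewrite /motion mulmxBr opprD addrACA subrr addr0.
by rewrite trmx_mul mulmxA -(mulmxA _ g.1^T) gE mulmx1.
Qed.

Lemma motion_segment (R : realType) (e : bool) (g : 'M[R]_2 * 'cV[R]_2)
    (p q : plane R) :
  motion g @` segment e p q = segment e (motion g p) (motion g q).
Proof.
have E t : motion g ((1 - t) *: p + t *: q) =
    (1 - t) *: motion g p + t *: motion g q.
  rewrite /motion mulmxDr -!scalemxAr !scalerDr addrACA -scalerDl subrK.
  by rewrite scale1r.
rewrite /segment image_comp; apply: eq_imagel => t _; exact: E.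
Qed.

Lemma segment_sym (R : realType) (e : bool) (p q : plane R) :
  segment e q p = segment e p q.
Proof.
suff sub (u v : plane R) : segment e u v `<=` segment e v u.
  by apply/seteqP; split; apply: sub.
move=> _ [t ht <-]; exists (1 - t); last by rewrite addrC subKr.
by move: ht; case: e => /= /andP[t0 t1]; apply/andP; split; lra.
Qed.

Lemma endpoint_segment (R : realType) (p q : plane R) : segment true p q p.
Proof.
exists 0; first by rewrite /= lexx ler01.
by rewrite subr0 scale1r scale0r addr0.
Qed.

Lemma can_move_subset (R : realType) (A B S S' : set (plane R)) :
  S' `<=` S -> can_move A B S -> can_move A B S'.
Proof.
move=> SS [Phi [cPhi E h0 h1 h]].
have sub g : motion g @` S' `<=` motion g @` S by exact: image_subset.
exists Phi; split=> //.
- exact: subset_trans (sub _) h0.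
- exact: subset_trans (sub _) h1.
- by move=> t /h; apply: subset_trans.
Qed.

Lemma movable_lengths_mono (R : realType) (e : bool)
    (A B A' B' : set (plane R)) : A `<=` A' -> B `<=` B' ->
  movable_lengths e A B `<=` movable_lengths e A' B'.
Proof.
move=> AA BB l [l0 [p [q [pq [Phi [cPhi E h0 h1 h]]]]]].
split=> //; exists p, q; split=> //; exists Phi; split=> //.
- exact: subset_trans h0 AA.
- exact: subset_trans h1 BB.
- by move=> t /h ht; apply: subset_trans ht _; apply: setUSS.
Qed.

Lemma movable_lengths_open (R : realType) (A B : set (plane R)) (e : bool) :
  movable_lengths true A B `<=` movable_lengths e A B.
Proof.
case: e => // l [l0 [p [q [pq mv]]]]; split=> //; exists p, q; split=> //.
apply: can_move_subset mv => _ [t /andP[t0 t1] <-]; exists t => //=.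
by rewrite !ltW.
Qed.

(** Trimming the fraction [r] at each end leaves a concentric closed segment that avoids the old
    endpoints, so it follows the same motion even when the given segment is open. This carries
    bounds for closed segments over to open ones. *)
Lemma movable_lengths_shorter (R : realType) (A B : set (plane R)) (e : bool)
    (l l' : R) : 0 < l' < l ->
  movable_lengths e A B l -> movable_lengths true A B l'.
Proof.
move=> /andP[l'0 l'l] [l0 [p [q [pq mv]]]]; split=> //.
pose r := (1 - l' / l) / 2.
have r1 : l' / l < 1 by rewrite ltr_pdivrMr// mul1r.
have r0 : 0 < l' / l by rewrite divr_gt0.
exists ((1 - r) *: p + r *: q), ((1 - r) *: q + r *: p); split.
  rewrite /eucl_dist !xcoordD !ycoordD !xcoordZ !ycoordZ.
  set u := xcoord p; set v := xcoord q.
  set u' := ycoord p; set v' := ycoord q.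
  have -> : ((1 - r) * u + r * v - ((1 - r) * v + r * u)) ^+ 2 +
      ((1 - r) * u' + r * v' - ((1 - r) * v' + r * u')) ^+ 2 =
      (1 - 2 * r) ^+ 2 * ((u - v) ^+ 2 + (u' - v') ^+ 2) by ring.
  rewrite -sqr_eucl_dist pq.
  have -> : 1 - 2 * r = l' / l by rewrite /r; field; rewrite gt_eqF.
  by rewrite -exprMn divfK ?gt_eqF// sqrtr_sqr ger0_norm// ltW.
apply: can_move_subset mv => _ [t /= /andP[t0 t1] <-].
exists ((1 - t) * r + t * (1 - r)).
  have r12 : 0 < r < 1 - r by rewrite /r; lra.
  have lo : 0 <= t * (1 - r - r) by rewrite mulr_ge0//; lra.
  have hi : 0 <= (1 - t) * (1 - r - r) by rewrite mulr_ge0//; lra.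
  by case: e; apply/andP; split; lra.
rewrite !scalerDr !scalerA addrACA [_ *: q + _ *: p]addrC addrACA -!scalerDl.
by congr (_ *: _ + _ *: _); ring.
Qed.

Lemma motion_continuous (R : realType) (r : plane R) (i : 'I_2) :
  continuous (fun g : 'M[R]_2 * 'cV[R]_2 => motion g r i 0).
Proof.
move=> t.
have -> : (fun g : 'M[R]_2 * 'cV[R]_2 => motion g r i 0) =
    (fun g => g.1 i 0 * r 0 0 + g.1 i 1 * r 1 0 + g.2 i 0).
  by apply/funext => g; rewrite /motion mxE mulmx2E.
have c1 j : {for t, continuous (fun g : 'M[R]_2 * 'cV[R]_2 => g.1 i j)}.
  apply: (@continuous_comp _ _ _ fst (fun M : 'M[R]_2 => M i j)).
    exact: cvg_fst.
  exact: coord_continuous.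
have c2 : {for t, continuous (fun g : 'M[R]_2 * 'cV[R]_2 => g.2 i 0)}.
  apply: (@continuous_comp _ _ _ snd (fun M : 'cV[R]_2 => M i 0)).
    exact: cvg_snd.
  exact: coord_continuous.
apply: cvgD; [apply: cvgD|exact: c2].
  by apply: cvgM; [exact: c1|exact: cvg_cst].
by apply: cvgM; [exact: c1|exact: cvg_cst].
Qed.

(** This is all that the upper bounds retain of a motion: two continuous curves of endpoints at
    constant distance. *)
Lemma moving_endpoints (R : realType) (A B : set (plane R)) (p q : plane R) :
  can_move A B (segment true p q) ->
  exists P Q : R -> plane R,
    [/\ (forall i, {within `[0, 1], continuous (fun t => P t i 0)}),
        (forall i, {within `[0, 1], continuous (fun t => Q t i 0)}) &
        forall t, 0 <= t <= 1 -> eucl_dist (P t) (Q t) = eucl_dist p q] /\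
    [/\ segment true (P 0) (Q 0) `<=` A,
        segment true (P 1) (Q 1) `<=` B &
        forall t, 0 <= t <= 1 -> segment true (P t) (Q t) `<=` A `|` B].
Proof.
move=> [Phi [cPhi E h0 h1 h]].
have cont (r : plane R) i :
    {within `[0, 1], continuous (fun t => motion (Phi t) r i 0)}.
  have cm : continuous (fun g : 'M[R]_2 * 'cV[R]_2 => motion g r i 0).
    exact: motion_continuous.
  by move=> t; exact: (continuous_comp (cPhi t) (cm _)).
exists (fun t => motion (Phi t) p), (fun t => motion (Phi t) q).
split; split; try by [move=> i; exact: cont].
- by move=> t /E; apply: motion_isometry.
- by rewrite -motion_segment.
- by rewrite -motion_segment.
- by move=> t /h; rewrite -motion_segment.
Qed.

(** * The critical slope and the upper bounds *)

Lemma eucl_distC (R : realType) (p q : plane R) :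
  eucl_dist p q = eucl_dist q p.
Proof.
by rewrite /eucl_dist -opprB sqrrN -[ycoord p - ycoord q]opprB sqrrN.
Qed.

(** For [u] equal to [al] or [be], a long segment whose extent in one direction is below the
    corridor width falls short of the critical extent [l * u / s] in that direction. *)
Lemma narrow_slope (R : realFieldType) (u s l z : R) :
  0 < u -> 0 < s -> u ^+ 2 <= s ^+ 2 -> s ^+ 3 <= l ->
  `|z| < u ^+ 3 -> `|z| * s < l * u.
Proof.
move=> u0 s0 us sl zu.
have h1 : `|z| * s < u ^+ 3 * s by rewrite ltr_pM2r.
have h2 : u ^+ 2 * (u * s) <= s ^+ 2 * (u * s) by rewrite ler_pM2r// mulr_gt0.
have h3 : s ^+ 3 * u <= l * u by rewrite ler_pM2r.
apply: lt_le_trans h1 _; apply: le_trans h3.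
have -> : u ^+ 3 * s = u ^+ 2 * (u * s) by ring.
by have -> : s ^+ 3 * u = s ^+ 2 * (u * s) by ring.
Qed.

(** By Pythagoras the squares of the two scaled extents have the same sum as those of the critical
    ones, so one extent is subcritical exactly when the other is supercritical. *)
Lemma slope_complement (R : realFieldType) (al be s l x y : R) :
  0 < al -> 0 < be -> 0 < s -> 0 < l -> s ^+ 2 = al ^+ 2 + be ^+ 2 ->
  x ^+ 2 + y ^+ 2 = l ^+ 2 ->
  ((`|x| * s < l * al) = (l * be < `|y| * s)) *
  ((`|x| * s == l * al) = (`|y| * s == l * be)).
Proof.
move=> al0 be0 s0 l0 s2 xy.
have E : (`|x| * s) ^+ 2 + (`|y| * s) ^+ 2 = (l * al) ^+ 2 + (l * be) ^+ 2.
  by rewrite !exprMn !real_normK ?num_real// -mulrDl -mulrDr xy s2.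
have xs0 : 0 <= `|x| * s by rewrite mulr_ge0// ltW.
have ys0 : 0 <= `|y| * s by rewrite mulr_ge0// ltW.
have la0 : 0 <= l * al by rewrite mulr_ge0 ?ltW.
have lb0 : 0 <= l * be by rewrite mulr_ge0 ?ltW.
split.
  rewrite -(ltr_pXn2r (_ : 0 < 2)%N)//.
  rewrite -[RHS](ltr_pXn2r (_ : 0 < 2)%N)//.
  by apply/idP/idP; lra.
rewrite -(eqrXn2 (_ : 0 < 2)%N)//; rewrite -[RHS](eqrXn2 (_ : 0 < 2)%N)//.
by apply/eqP/eqP; lra.
Qed.

Section upper_bounds.
Variables (R : realType) (al be s l : R).
Hypotheses (al0 : 0 < al) (be0 : 0 < be) (s0 : 0 < s) (l0 : 0 < l).
Hypothesis s2 : s ^+ 2 = al ^+ 2 + be ^+ 2.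

Let a := al ^+ 3.
Let b := be ^+ 3.

Let al_le_s : al ^+ 2 <= s ^+ 2.
Proof. by rewrite s2 lerDl sqr_ge0. Qed.

Let be_le_s : be ^+ 2 <= s ^+ 2.
Proof. by rewrite s2 lerDr sqr_ge0. Qed.

(** Critical height means critical width, and a width below [a] would be subcritical. *)
Let critical_width (P Q : plane R) : s ^+ 3 <= l -> eucl_dist P Q = l ->
  `|ycoord P - ycoord Q| * s = l * be -> a <= `|xcoord P - xcoord Q|.
Proof.
move=> sl PQ /eqP hy; rewrite leNgt; apply/negP.
move=> /(narrow_slope _ _ _ _ _ al0 s0 al_le_s sl).
have := sqr_eucl_dist _ P Q; rewrite PQ => /esym E.
have [_ C] := slope_complement _ _ _ _ _ _ _ al0 be0 s0 l0 s2 E.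
by move: hy; rewrite -C => /eqP ->; rewrite ltxx.
Qed.

(** Width at least [a] puts [Q] beyond the door, hence into the strip; height at least [b] then
    keeps [P] on the near side. The crossing point and [Q] both have ordinates in (0, b), whichever
    way the segment leans. *)
Lemma crossing_strip_corridor (P Q : plane R) :
  segment true P Q `<=` A0 a b `|` B3 a b -> eucl_dist P Q = l ->
  `|ycoord P - ycoord Q| * s = l * be -> xcoord P <= xcoord Q -> l < s ^+ 3.
Proof.
move=> sub PQ hy xPQ; rewrite ltNge; apply/negP => sl.
have := critical_width _ _ sl PQ hy; rewrite distrC ger0_norm ?subr_ge0// => hx.
have hyb : b <= `|ycoord P - ycoord Q|.
  rewrite leNgt; apply/negP => /(narrow_slope _ _ _ _ _ be0 s0 be_le_s sl).
  by rewrite hy ltxx.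
have a0 : 0 < a by rewrite exprn_gt0.
have inP : 0 < xcoord P /\ (a <= xcoord P -> 0 < ycoord P < b).
  have := sub _ (endpoint_segment _ P Q).
  by move=> [[[->//]|/andP[? ?]]|[[[->//]|/= ?] ?]]; split; lra.
have inQ : a < xcoord Q -> 0 < ycoord Q < b.
  have := sub Q; rewrite -segment_sym => /(_ (endpoint_segment _ Q P)).
  by move=> [[[->//]|/andP[? ?]]|[[[->//]|/= ?] ?]]; lra.
case: inP => xP0 inP.
have {}inQ : 0 < ycoord Q < b by apply: inQ; lra.
have xPa : xcoord P < a.
  rewrite ltNge; apply/negP => /inP yP.
  by move: hyb; rewrite leNgt ltr_norml; move/negP; apply; lra.
have hQ : a < xcoord Q by lra.
suff : l < s ^+ 3 by lra.
apply: (crossing_bound _ al be s l _ (ycoord P) _ (ycoord Q)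
  al0 be0 s0 s2 xP0 xPa hQ) => //.
  have := sqr_eucl_dist _ P Q; rewrite PQ => /esym E.
  have [_ C] := slope_complement _ _ _ _ _ _ _ al0 be0 s0 l0 s2 E.
  move/eqP: hy; rewrite -C => /eqP <-.
  by rewrite distrC ger0_norm// subr_ge0.
move=> t t01 tx; set y := _ + t * ycoord Q.
have yE : ycoord ((1 - t) *: P + t *: Q) = y by rewrite ycoordD !ycoordZ.
have xE : xcoord ((1 - t) *: P + t *: Q) = a by rewrite xcoordD !xcoordZ.
have : 0 < y < b.
  have : segment true P Q ((1 - t) *: P + t *: Q) by exists t.
  move/sub; rewrite -yE.
  by move=> [[[_ //]|/=]|[_ //]]; rewrite xE ltxx andbF.
move=> /andP[y0 yb]; case/andP: inQ => yQ0 yQb.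
by rewrite -/b ltr_norml; apply/andP; split; lra.
Qed.

(** Ordinates are bounded only below here, so [P] must be the upper end. It lies above [b], hence
    not in the door, and the width forces [Q] to the far side. The crossing point lies above [Q] and
    below [b], which bounds its height over [Q]. *)
Lemma crossing_half_strip_quadrant (P Q : plane R) :
  segment true P Q `<=` A1 a b `|` B1 a b -> eucl_dist P Q = l ->
  (ycoord P - ycoord Q) * s = l * be -> xcoord P <= a -> l < s ^+ 3.
Proof.
move=> sub PQ hy xPa; rewrite ltNge; apply/negP => sl.
have yPQ : 0 < ycoord P - ycoord Q by rewrite -(pmulr_lgt0 _ s0) hy mulr_gt0.
have hy' : `|ycoord P - ycoord Q| * s = l * be by rewrite gtr0_norm.
have := critical_width _ _ sl PQ hy' => hx.
have hyb : b <= ycoord P - ycoord Q.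
  rewrite -[X in _ <= X]gtr0_norm// leNgt; apply/negP.
  move=> /(narrow_slope _ _ _ _ _ be0 s0 be_le_s sl).
  by rewrite hy' ltxx.
have a0 : 0 < a by rewrite exprn_gt0.
have inC p : segment true P Q p ->
    [/\ 0 < xcoord p, 0 < ycoord p & xcoord p = a -> ycoord p < b].
  move=> /sub.
  by move=> [[[[-> /andP[? ?]]|/andP[? ?]] /= ?]|[[[-> /andP[? ?]]|/= ?] /= ?]];
    split=> //; lra.
have [xP0 yP0 inP] := inC _ (endpoint_segment _ P Q).
have [xQ0 yQ0 _] : [/\ 0 < xcoord Q, 0 < ycoord Q & True].
  by have [] := inC Q; first by rewrite -segment_sym; exact: endpoint_segment.
have {}xPa : xcoord P < a.
  by rewrite lt_neqAle xPa andbT; apply/eqP => /inP; lra.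
have xPQ : xcoord P - xcoord Q < 0.
  rewrite ltNge; apply/negP => h; move: hx; rewrite ger0_norm//; lra.
have hQ : a < xcoord Q.
  move: hx; rewrite ltr0_norm//; lra.
suff : l < s ^+ 3 by lra.
apply: (crossing_bound _ al be s l _ (ycoord P) _ (ycoord Q)
  al0 be0 s0 s2 xP0 xPa hQ) => //.
  have := sqr_eucl_dist _ P Q; rewrite PQ => /esym E.
  have [_ C] := slope_complement _ _ _ _ _ _ _ al0 be0 s0 l0 s2 E.
  move/eqP: hy'; rewrite -C => /eqP <-.
  by rewrite ltr0_norm// opprB.
move=> t t01 tx; set y := _ + t * ycoord Q.
have yE : ycoord ((1 - t) *: P + t *: Q) = y by rewrite ycoordD !ycoordZ.
have xE : xcoord ((1 - t) *: P + t *: Q) = a by rewrite xcoordD !xcoordZ.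
have yb : y < b.
  rewrite -yE; have [|_ _] := inC ((1 - t) *: P + t *: Q); first by exists t.
  exact.
have yQ : y - ycoord Q = (1 - t) * (ycoord P - ycoord Q) by rewrite /y; ring.
have : 0 <= y - ycoord Q by rewrite yQ mulr_ge0//; lra.
by move=> h; rewrite -/b ger0_norm//; lra.
Qed.

(** The scaled height [f] is supercritical at the start and subcritical at the end, so it is
    critical at some time, and a long segment would then cross the door. *)
Lemma strip_corridor_bound :
  movable_lengths true (A0 a b) (B3 a b) l -> l < s ^+ 3.
Proof.
move=> [_ [p [q [pq /moving_endpoints[P [Q [[cP cQ dPQ] [h0 h1 h]]]]]]]].
rewrite ltNge; apply/negP => sl.
have a0 : 0 < a by rewrite exprn_gt0.
have {}dPQ t : 0 <= t <= 1 -> eucl_dist (P t) (Q t) = l by move/dPQ; rewrite pq.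
pose f t := `|ycoord (P t) - ycoord (Q t)| * s.
have cf : {within `[0, 1], continuous f}.
  move=> t; apply: cvgM; last exact: cvg_cst.
  by apply: cvg_norm; apply: cvgB; [exact: cP|exact: cQ].
(* At the start the width is below [a], which makes the height supercritical. *)
have f0 : l * be < f 0.
  have E := sqr_eucl_dist _ (P 0) (Q 0); rewrite dPQ ?lexx ?ler01// in E.
  have [<- _] := slope_complement _ _ _ _ _ _ _ al0 be0 s0 l0 s2 (esym E).
  apply: narrow_slope => //.
  have := h0 _ (endpoint_segment _ _ _).
  have := h0 (Q 0); rewrite -segment_sym => /(_ (endpoint_segment _ _ _)).
  rewrite -/a ltr_norml => -[[xQ _]|/= xQ] [[xP _]|/= xP]; lra.
have f1 : f 1 < l * be.
  apply: narrow_slope => //.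
  have [_ /= yP] := h1 _ (endpoint_segment _ _ _).
  have := h1 (Q 1); rewrite -segment_sym => /(_ (endpoint_segment _ _ _)).
  by move=> [_ /= yQ]; rewrite -/b ltr_norml; lra.
have [|t] := IVT (v := l * be) ler01 cf.
  by rewrite ge_min le_max (ltW f1) (ltW f0) orbT.
rewrite in_itv/= => t01 ft; suff : l < s ^+ 3 by lra.
(* Either endpoint may be the left one at the critical time; the situation is symmetric. *)
have [PQ|QP] := leP (xcoord (P t)) (xcoord (Q t)).
  by apply: crossing_strip_corridor (h t t01) (dPQ t t01) ft PQ.
apply: (@crossing_strip_corridor (Q t) (P t)) => //; last exact: ltW.
- by rewrite segment_sym; exact: h.
- by rewrite eucl_distC dPQ.
- by rewrite distrC.
Qed.

(* As long as the slope stays steep the upper endpoint remains the same, and it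
   is too high to pass through the door. *)
Let half_strip_quadrant_aux (P Q : R -> plane R) :
  (forall i, {within `[0, 1], continuous (fun t => P t i 0)}) ->
  (forall i, {within `[0, 1], continuous (fun t => Q t i 0)}) ->
  (forall t, 0 <= t <= 1 -> eucl_dist (P t) (Q t) = l) ->
  segment true (P 0) (Q 0) `<=` A1 a b ->
  segment true (P 1) (Q 1) `<=` B1 a b ->
  (forall t, 0 <= t <= 1 ->
     segment true (P t) (Q t) `<=` A1 a b `|` B1 a b) ->
  ycoord (Q 0) <= ycoord (P 0) -> l < s ^+ 3.
Proof.
move=> cP cQ dPQ h0 h1 h QP0; rewrite ltNge; apply/negP => sl.
have a0 : 0 < a by rewrite exprn_gt0.
pose f t := (ycoord (P t) - ycoord (Q t)) * s - l * be.
(* At a zero of this minimum both terms are nonnegative and one vanishes. As [high] forbids [P] to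
   reach abscissa [a] while [f] is nonnegative, it is [f] that vanishes, with [P] still on the near
   side. *)
pose g t := Num.min (f t) (a - xcoord (P t)).
have cg : {within `[0, 1], continuous g}.
  move=> t; apply: continuous_min.
    apply: cvgB; last exact: cvg_cst.
    apply: cvgM; last exact: cvg_cst.
    by apply: cvgB; [exact: cP|exact: cQ].
  by apply: cvgB; [exact: cvg_cst|exact: cP].
have high t : 0 <= t <= 1 -> 0 <= f t -> xcoord (P t) != a.
  move=> t01 ft; apply/eqP => xP.
  have hb : b <= ycoord (P t) - ycoord (Q t).
    have d0 : 0 <= ycoord (P t) - ycoord (Q t).
      have := mulr_gt0 l0 be0; rewrite -(pmulr_lge0 _ s0).
      by move: ft; rewrite /f; lra.
    rewrite -[X in _ <= X]ger0_norm// leNgt; apply/negP.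
    move=> /(narrow_slope _ _ _ _ _ be0 s0 be_le_s sl).
    by rewrite ger0_norm//; move: ft; rewrite /f; lra.
  have yP : ycoord (P t) < b.
    have := h t t01 _ (endpoint_segment _ _ _).
    by move=> [[[[_ /andP[]//]|/= xP'] _]|[[[_ /andP[]//]|/= xP'] _]]; lra.
  have yQ : 0 < ycoord (Q t).
    have := h t t01 (Q t); rewrite -segment_sym.
    by move=> /(_ (endpoint_segment _ _ _)) [[_ //]|[_ //]].
  lra.
have g0 : 0 <= g 0.
  rewrite /g le_min; apply/andP; split; last first.
    by have [[[->]|/= ?] _] := h0 _ (endpoint_segment _ _ _); lra.
  have E := sqr_eucl_dist _ (P 0) (Q 0); rewrite dPQ ?lexx ?ler01// in E.
  have [C _] := slope_complement _ _ _ _ _ _ _ al0 be0 s0 l0 s2 (esym E).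
  rewrite /f subr_ge0 ltW// -[ycoord _ - _]ger0_norm ?subr_ge0// -C.
  apply: narrow_slope => //.
  have := h0 _ (endpoint_segment _ _ _).
  have := h0 (Q 0); rewrite -segment_sym => /(_ (endpoint_segment _ _ _)).
  by rewrite -/a ltr_norml => -[[[xQ _]|/= xQ] _] [[[xP _]|/= xP] _]; lra.
have g1 : g 1 <= 0.
  rewrite /g ge_min; apply/orP; right.
  by have [[[->]|/= ?] _] := h1 _ (endpoint_segment _ _ _); lra.
have [|t] := IVT (v := 0) ler01 cg.
  by rewrite ge_min le_max g1 g0 orbT.
rewrite in_itv/= => t01 gt; suff : l < s ^+ 3 by lra.
have [ft xP] : 0 <= f t /\ 0 <= a - xcoord (P t).
  by apply/andP; rewrite -le_min -/(g t) gt.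
have {}ft : f t = 0.
  move: gt; rewrite /g; case: (leP (f t) (a - xcoord (P t))) => // _ xa.
  by have /eqP := high t t01 ft; lra.
apply: crossing_half_strip_quadrant (h t t01) (dPQ t t01) _ _; last by lra.
by move: ft; rewrite /f; lra.
Qed.

Lemma half_strip_quadrant_bound :
  movable_lengths true (A1 a b) (B1 a b) l -> l < s ^+ 3.
Proof.
move=> [_ [p [q [pq /moving_endpoints[P [Q [[cP cQ dPQ] [h0 h1 h]]]]]]]].
have [QP|PQ] := leP (ycoord (Q 0)) (ycoord (P 0)).
  by apply: half_strip_quadrant_aux cP cQ _ h0 h1 h QP => t /dPQ ->.
apply: half_strip_quadrant_aux cQ cP _ _ _ _ (ltW PQ).
- by move=> t t01; rewrite eucl_distC dPQ.
- by rewrite segment_sym.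
- by rewrite segment_sym.
- by move=> t t01; rewrite segment_sym; exact: h.
Qed.

End upper_bounds.

(** * Explicit motions *)

Lemma motion_path_continuous (R : realType) (M : R -> 'M[R]_2)
    (v : R -> 'cV[R]_2) :
  continuous M -> continuous v ->
  {within `[0, 1], continuous (fun t => (M t, v t))}.
Proof.
move=> cM cv; apply: continuous_subspaceT => t.
exact: (cvg_pair (G := nbhs (M t)) (H := nbhs (v t)) (cM t) (cv t)).
Qed.

Definition point (R : realType) (x y : R) : plane R :=
  \col_i (if i == 0 then x else y).

Lemma xcoord_point (R : realType) (x y : R) : xcoord (point R x y) = x.
Proof. by rewrite /xcoord mxE. Qed.

Lemma ycoord_point (R : realType) (x y : R) : ycoord (point R x y) = y.
Proof. by rewrite /ycoord mxE. Qed.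

Lemma plane_eqP (R : realType) (p q : plane R) :
  xcoord p = xcoord q -> ycoord p = ycoord q -> p = q.
Proof.
move=> xE yE; apply/matrixP => i j; rewrite [j]ord1.
by have /orP[/eqP->//|/eqP->//] : (i == 0) || (i == 1) by case: i => -[|[|[]]].
Qed.

(** If the line of slope [k] through a door point runs inside the corridor, a translation along it
    moves any of its segments of horizontal width at most [a / 3]. *)
Lemma sliding_movable (R : realType) (a w k l y0 : R) (A B : set (plane R)) :
  0 < w -> w <= a / 3 -> 0 < l -> w ^+ 2 * (1 + k ^+ 2) = l ^+ 2 ->
  (forall x, 0 < x < a -> A (point R x (y0 + k * (x - a)))) ->
  (forall x, a < x -> B (point R x (y0 + k * (x - a)))) ->
  A (point R a y0) ->
  movable_lengths true A B l.
Proof.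
move=> w0 wa l0 wl hA hB hD; split=> //.
pose L x := point R x (y0 + k * (x - a)).
(* The abscissas start within [a / 3] and [2 * a / 3]; a shift by [a] then takes all of them beyond
   the door. *)
exists (L (a / 3)), (L (a / 3 + w)); split.
  rewrite /eucl_dist !xcoord_point !ycoord_point.
  rewrite -[RHS](ger0_norm (ltW l0)) -sqrtr_sqr -wl; congr Num.sqrt; ring.
pose Phi t : 'M[R]_2 * 'cV[R]_2 := (1%:M, t *: point R a (k * a)).
have PhiE t r : motion (Phi t) ((1 - r) *: L (a / 3) + r *: L (a / 3 + w)) =
    L (a / 3 + r * w + t * a).
  rewrite /motion mul1mx; apply: plane_eqP.
    by rewrite !(xcoordD, xcoordZ, xcoord_point); ring.
  by rewrite !(ycoordD, ycoordZ, ycoord_point); ring.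
have rw r : 0 <= r <= 1 -> 0 <= r * w <= w.
  by move=> /andP[r0 r1]; rewrite mulr_ge0 ?(ltW w0)//= ger_pMl.
exists Phi; split.
- apply: motion_path_continuous => t; first exact: cvg_cst.
  by apply: cvgZr_tmp; exact: cvg_id.
- by move=> t _; rewrite /E2/= trmx1 mul1mx.
- by move=> _ [_ [r /= /rw r01 <-] <-]; rewrite PhiE; apply: hA; lra.
- by move=> _ [_ [r /= /rw r01 <-] <-]; rewrite PhiE; apply: hB; lra.
- move=> t /andP[t0 t1] _ [_ [r /= /rw r01 <-] <-]; rewrite PhiE.
  have ta : 0 <= t * a by rewrite mulr_ge0//; lra.
  case: (ltgtP (a / 3 + r * w + t * a) a) => [h|h|->].
  + by left; apply: hA; lra.
  + by right; apply: hB.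
  + by left; rewrite /L subrr mulr0 addr0.
Qed.

(** A falling line through the middle of the door suits the first corridor, a rising one the second;
    steepness fits any length into the width [w]. *)
Lemma unbounded_corridors (R : realType) (a b l : R) :
  0 < a -> 0 < b -> 0 < l ->
  movable_lengths true (A1 a b) (B2 a b) l /\
  movable_lengths true (A0 a b) (B1 a b) l.
Proof.
move=> a0 b0 l0.
(* The bound by [l] keeps the radicand in [k] nonnegative. *)
pose w := Num.min (a / 3) l.
have w0 : 0 < w by rewrite lt_min l0 divr_gt0.
have wa : w <= a / 3 by rewrite ge_min lexx.
have wl : w <= l by rewrite ge_min lexx orbT.
pose k := Num.sqrt (l ^+ 2 / w ^+ 2 - 1).
have w20 : 0 < w ^+ 2 by rewrite exprn_gt0.
have k2 : w ^+ 2 * (1 + k ^+ 2) = l ^+ 2.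
  rewrite sqr_sqrtr; first by field; rewrite gt_eqF.
  by rewrite subr_ge0 ler_pdivlMr// mul1r lerXn2r// nnegrE ltW.
have k0 : 0 <= k by exact: sqrtr_ge0.
have door : @door R a b (point R a (b / 2)).
  by rewrite /door/= xcoord_point ycoord_point; split=> //; lra.
split.
  apply: (@sliding_movable R a w (- k) l (b / 2)) => //.
  - by rewrite sqrrN.
  - move=> x /andP[x0 xa]; have h : 0 <= k * (a - x) by rewrite mulr_ge0//; lra.
    split=> /=; first by right; rewrite /= xcoord_point x0.
    by rewrite ycoord_point; lra.
  - move=> x xa; have h : 0 <= k * (x - a) by rewrite mulr_ge0//; lra.
    split=> /=; first by right; rewrite /= xcoord_point.
    by rewrite ycoord_point; lra.
  - by split; [left|rewrite /= ycoord_point; lra].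
apply: (@sliding_movable R a w k l (b / 2)) => //.
- by move=> x xa; right; rewrite /= xcoord_point.
- move=> x xa; have h : 0 <= k * (x - a) by rewrite mulr_ge0//; lra.
  split=> /=; first by right; rewrite /= xcoord_point.
  by rewrite ycoord_point; lra.
- by left.
Qed.

Lemma L_corridorP (R : realType) (a b : R) (p : plane R) :
  0 < xcoord p -> 0 < ycoord p -> xcoord p < a \/ ycoord p < b ->
  (A1 a b `|` B3 a b) p.
Proof.
move=> x0 y0; case: (ltgtP (xcoord p) a) => xa [//|] h.
- by left; split=> //; right; rewrite /= x0.
- by left; split=> //; right; rewrite /= x0.
- by right; split; [right|apply/andP].
- by left; split=> //; left; split=> //; apply/andP.
Qed.

(** The clockwise rotation with cosine [c] and sine [s], as a linear combination of fixed matrices,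
    which makes continuity in [c] and [s] immediate. *)
Definition rotation (R : realType) (c s : R) : 'M[R]_2 :=
  c *: 1%:M + s *: \matrix_(i, j) (j%:R - i%:R).

Lemma rotationE (R : realType) (c s : R) :
  [/\ rotation R c s 0 0 = c, rotation R c s 0 1 = s,
      rotation R c s 1 0 = - s & rotation R c s 1 1 = c].
Proof.
by split; rewrite !mxE /=
  !(subr0, sub0r, subrr, mulr0, mulr1, mulrN1, addr0, add0r).
Qed.

Lemma rotation_mul (R : realType) (c s : R) (p : plane R) :
  rotation R c s *m p =
  point R (c * xcoord p + s * ycoord p) (c * ycoord p - s * xcoord p).
Proof.
have [r00 r01 r10 r11] := rotationE R c s.
apply: plane_eqP; rewrite ?xcoord_point ?ycoord_point /xcoord /ycoord mulmx2E.
  by rewrite r00 r01.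
by rewrite r10 r11 mulNr addrC.
Qed.

Lemma rotation_orthogonal (R : realType) (c s : R) :
  c ^+ 2 + s ^+ 2 = 1 -> (rotation R c s)^T *m rotation R c s = 1%:M.
Proof.
move=> cs; have := rotationE R c s.
move: (rotation R c s) => M [r00 r01 r10 r11].
have ord2 (i : 'I_2) : i = 0 \/ i = 1.
  by case: i => -[|[|[]]]// ?; [left|right]; apply/val_inj.
apply/matrixP => i j; rewrite mulmx2E !mxE.
by case: (ord2 i) => ->; case: (ord2 j) => -> /=;
  rewrite ?(r00, r01, r10, r11) ?mulr1n -?cs; ring.
Qed.

(** For a ladder leaning on two perpendicular walls, [r * l * c] and [(1 - r) * l * s] are the
    distances of one of its points from them. If the point were beyond the corner of the corridor
    scaled by [k], then [ladder_le] would give [k * S ^+ 3 <= l]. *)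
Lemma ladder_in_L_corridor (R : realType) (a b al be S k l c s r : R) :
  0 < al -> 0 < be -> 0 < S -> S ^+ 2 = al ^+ 2 + be ^+ 2 ->
  a = al ^+ 3 -> b = be ^+ 3 -> 0 < k -> 0 < l -> l < k * S ^+ 3 ->
  0 <= c -> 0 <= s -> c ^+ 2 + s ^+ 2 = 1 -> 0 <= r <= 1 ->
  r * l * c < k * a \/ (1 - r) * l * s < k * b.
Proof.
move=> al0 be0 S0 S2 aE bE k0 l0 lS c0 s0 cs /andP[r0 r1].
have [|ca] := ltP (r * l * c) (k * a); first by left.
have [|sb] := ltP ((1 - r) * l * s) (k * b); first by right.
have ka : 0 < k * a by rewrite mulr_gt0// aE exprn_gt0.
have kb : 0 < k * b by rewrite mulr_gt0// bE exprn_gt0.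
have {}c0 : 0 < c.
  rewrite lt_neqAle c0 andbT; apply/eqP => c0'.
  by move: ca; rewrite -c0' mulr0; lra.
have {}s0 : 0 < s.
  rewrite lt_neqAle s0 andbT; apply/eqP => s0'.
  by move: sb; rewrite -s0' mulr0; lra.
have := ladder_le _ _ _ _ _ _ al0 be0 S0 S2 c0 s0 cs.
rewrite -aE -bE -(ler_pM2l k0) mulrDr !mulrA => h.
have h1 : k * a / c <= r * l by rewrite ler_pdivrMr.
have h2 : k * b / s <= (1 - r) * l by rewrite ler_pdivrMr.
lra.
Qed.

(** Up to time 1/2 the ladder turns from vertical to horizontal with its ends on the lines at
    [(1 - k) * a] and [(1 - k) * b]; afterwards it slides to the right by [a]. *)
Lemma L_corridor_movable (R : realType) (a b al be S l : R) :
  0 < al -> 0 < be -> 0 < S -> S ^+ 2 = al ^+ 2 + be ^+ 2 ->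
  a = al ^+ 3 -> b = be ^+ 3 -> 0 < l < S ^+ 3 ->
  movable_lengths true (A1 a b) (B3 a b) l.
Proof.
move=> al0 be0 S0 S2 aE bE /andP[l0 lS].
have a0 : 0 < a by rewrite aE exprn_gt0.
have b0 : 0 < b by rewrite bE exprn_gt0.
have S30 : 0 < S ^+ 3 by rewrite exprn_gt0.
(* The midpoint of [l / S ^+ 3] and 1: the scaled corridor still admits length [l], and the guiding
   lines keep off the outer walls. *)
pose k := (1 + l / S ^+ 3) / 2.
have lS1 : l / S ^+ 3 < 1 by rewrite ltr_pdivrMr// mul1r.
have lS0 : 0 < l / S ^+ 3 by rewrite divr_gt0.
have k0 : 0 < k by rewrite /k; lra.
have k1 : k < 1 by rewrite /k; lra.
have lk : l < k * S ^+ 3 by rewrite -ltr_pdivrMr// /k; lra.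
have ka : 0 < k * a < a by rewrite mulr_gt0//= gtr_pMl.
have kb : 0 < k * b < b by rewrite mulr_gt0//= gtr_pMl.
split=> //; exists (point R 0 0), (point R l 0); split.
  rewrite /eucl_dist !xcoord_point !ycoord_point subrr expr0n addr0 sub0r.
  by rewrite sqrrN sqrtr_sqr ger0_norm// ltW.
(* The cosine serves as the clock of the turn and then stays at 1, so that [2 * t - c t] is zero
   during the turn and measures the slide after it. *)
pose c t : R := Num.min (2 * t) 1.
pose s t := Num.sqrt (1 - c t ^+ 2).
pose x t := (1 - k) * a + (2 * t - c t) * a.
pose y t := (1 - k) * b + s t * l.
pose Phi t : 'M[R]_2 * 'cV[R]_2 :=
  (rotation R (c t) (s t), x t *: point R 1 0 + y t *: point R 0 1).
have c01 t : 0 <= t <= 1 -> 0 <= c t <= 1.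
  by move=> t01; rewrite le_min ge_min lexx orbT; lra.
have cs t : 0 <= t <= 1 -> c t ^+ 2 + s t ^+ 2 = 1.
  move=> /c01/andP[c0 c1]; rewrite sqr_sqrtr; first by ring.
  by rewrite subr_ge0 expr_le1.
have PhiE t r : motion (Phi t) ((1 - r) *: point R 0 0 + r *: point R l 0) =
    point R (r * l * c t + x t) ((1 - k) * b + (1 - r) * l * s t).
  rewrite /motion rotation_mul; apply: plane_eqP.
    by rewrite !(xcoordD, xcoordZ, ycoordZ, xcoord_point, ycoord_point)
      ycoordD !ycoordZ !ycoord_point; ring.
  by rewrite !(ycoordD, ycoordZ, xcoordD, xcoordZ, xcoord_point, ycoord_point)
    /y; ring.
have cc : continuous c.
  move=> t; apply: continuous_min; last exact: cvg_cst.
  by apply: cvgM; [exact: cvg_cst|exact: cvg_id].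
(* Outside [0, 1] the radicand can be negative; the default value 0 of the square root preserves
   continuity. *)
have csn : continuous s.
  move=> t; apply: (@continuous_comp _ _ _ (fun t => 1 - c t ^+ 2) Num.sqrt).
    apply: cvgB; first exact: cvg_cst.
    by apply: cvgM; exact: cc.
  exact: sqrt_continuous.
have cx : continuous x.
  move=> t; apply: cvgD; first exact: cvg_cst.
  apply: cvgM; last exact: cvg_cst.
  apply: cvgB; last exact: cc.
  by apply: cvgM; [exact: cvg_cst|exact: cvg_id].
have cy : continuous y.
  move=> t; apply: cvgD; first exact: cvg_cst.
  by apply: cvgM; [exact: csn|exact: cvg_cst].
exists Phi; split.
- apply: motion_path_continuous => t.
    by apply: cvgD; apply: cvgZr_tmp; [exact: cc|exact: csn].
  by apply: cvgD; apply: cvgZr_tmp; [exact: cx|exact: cy].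
- by move=> t t01; apply: rotation_orthogonal; exact: cs.
- move=> _ [_ [r /= /andP[r0 r1] <-] <-]; rewrite PhiE.
  have c0 : c 0 = 0 by rewrite /c mulr0 min_l.
  have x0 : x 0 = (1 - k) * a by rewrite /x c0 mulr0 subrr mul0r addr0.
  have h : 0 <= (1 - r) * l * s 0.
    by rewrite !mulr_ge0 ?sqrtr_ge0 ?(ltW l0)//; lra.
  split; last by rewrite /= ycoord_point; lra.
  by right; rewrite /= xcoord_point c0 x0; lra.
- move=> _ [_ [r /= /andP[r0 r1] <-] <-]; rewrite PhiE.
  have c1 : c 1 = 1 by rewrite /c min_r//; lra.
  have s1 : s 1 = 0 by rewrite /s c1 expr1n subrr sqrtr0.
  have x1 : x 1 = (1 - k) * a + a by rewrite /x c1; ring.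
  have h : 0 <= r * l by rewrite mulr_ge0// ltW.
  split; last by rewrite /= ycoord_point s1; lra.
  by right; rewrite /= xcoord_point c1 x1; lra.
- move=> t t01 _ [_ [r /= r01 <-] <-]; rewrite PhiE.
  have /andP[c0 c1] := c01 t t01.
  have s0 : 0 <= s t by exact: sqrtr_ge0.
  have /andP[r0 r1] := r01.
  have h1 : 0 <= r * l * c t by rewrite !mulr_ge0// ltW.
  have h2 : 0 <= (1 - r) * l * s t by rewrite !mulr_ge0 ?(ltW l0)//; lra.
  have mx0 : 0 <= (2 * t - c t) * a.
    by rewrite mulr_ge0 ?(ltW a0)// subr_ge0 ge_min lexx.
  apply: L_corridorP; rewrite ?xcoord_point ?ycoord_point /x; try lra.
  (* During the turn the ladder estimate applies, shifted by the guiding lines; during the slide the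
     ordinate is constantly [(1 - k) * b]. *)
  have [t2|t2] := leP (2 * t) 1.
    have ct : c t = 2 * t by rewrite /c min_l.
    rewrite -ct subrr mul0r addr0.
    have [|] := ladder_in_L_corridor R a b al be S k l (c t) (s t) r
      al0 be0 S0 S2 aE bE k0 l0 lk c0 s0 (cs t t01) r01; [left|right]; lra.
  right; have ct : c t = 1 by rewrite /c min_r// ltW.
  by rewrite /s ct expr1n subrr sqrtr0; lra.
Qed.

(** * Suprema and arbitrary lengths for the eight corridors *)

Theorem corollary2 (R : realType) (a b : R) (a_gt0 : 0 < a) (b_gt0 : 0 < b)
    (e : bool) :
  let L := (a `^ (2 / 3) + b `^ (2 / 3)) `^ (3 / 2) in
  [/\ supremums (movable_lengths e (A0 a b) (B3 a b)) L,
      supremums (movable_lengths e (A1 a b) (B1 a b)) L &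
      supremums (movable_lengths e (A1 a b) (B3 a b)) L] /\
  (forall l : R, 0 < l ->
    [/\ movable_lengths e (A0 a b) (B0 a b) l,
        movable_lengths e (A0 a b) (B1 a b) l,
        movable_lengths e (A0 a b) (B2 a b) l,
        movable_lengths e (A1 a b) (B0 a b) l &
        movable_lengths e (A1 a b) (B2 a b) l]).
Proof.
move=> L.
have [al [be [s [[al0 be0 s0] [aE bE s2 sE]]]]] :=
  cube_roots_data _ _ _ a_gt0 b_gt0.
have A10 : A1 a b `<=` A0 a b by exact: subIsetl.
have B10 : B1 a b `<=` B0 a b by exact: subIsetl.
have B20 : B2 a b `<=` B0 a b by exact: subIsetl.
have B31 : B3 a b `<=` B1 a b by move=> p [Bp /andP[yp _]].
(* The corridor of [A1] and [B3] lies in the other two bounded ones, so it supplies the lower bound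
   for all three. *)
have attained (l : R) : 0 < l < L -> movable_lengths e (A1 a b) (B3 a b) l.
  rewrite /L -sE => l0L; apply: movable_lengths_open.
  by apply: L_corridor_movable s2 (esym aE) (esym bE) l0L.
have sup A B : A1 a b `<=` A -> B3 a b `<=` B ->
    (forall l, movable_lengths true A B l -> l < L) ->
    supremums (movable_lengths e A B) L.
  move=> A1A B3B bound; split.
    move=> l hl; rewrite leNgt; apply/negP => Ll.
    have L0 : 0 < L by rewrite /L -sE exprn_gt0.
    (* A closed segment of this intermediate length would be movable and longer than [L]. *)
    have L'l : 0 < (L + l) / 2 < l by lra.
    by have := bound _ (movable_lengths_shorter _ _ _ _ _ _ L'l hl); lra.
  move=> u ub; rewrite leNgt; apply/negP => uL.
  have L0 : 0 < L by rewrite /L -sE exprn_gt0.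
  (* Only positive lengths are in the set, so the midpoint of [u] and [L] can be tested only once
     [u] is known to be positive. *)
  have u0 : 0 < u.
    have : 0 < L / 2 < L by lra.
    by move=> /attained/(movable_lengths_mono _ _ _ _ _ _ A1A B3B)/ub; lra.
  have : 0 < (u + L) / 2 < L by lra.
  by move=> /attained/(movable_lengths_mono _ _ _ _ _ _ A1A B3B)/ub; lra.
have bound03 l : movable_lengths true (A0 a b) (B3 a b) l -> l < L.
  move=> hl; have l0 := hl.1; move: hl; rewrite /L -sE -aE -bE.
  exact: strip_corridor_bound.
have bound11 l : movable_lengths true (A1 a b) (B1 a b) l -> l < L.
  move=> hl; have l0 := hl.1; move: hl; rewrite /L -sE -aE -bE.
  exact: half_strip_quadrant_bound.
split.
  split; apply: sup => // l hl; apply: bound03.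
  exact: movable_lengths_mono hl.
(* The other three corridors contain the one of [A1] and [B2]. *)
move=> l l0; have [m12 m01] := unbounded_corridors _ _ _ _ a_gt0 b_gt0 l0.
split; apply: movable_lengths_open => //.
- exact: movable_lengths_mono m12.
- exact: movable_lengths_mono m12.
- exact: movable_lengths_mono m12.
Qed.
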